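(* Let $G$ be a connected graph belonging to $\mathbf{W}_2$, with $n=n(G)$ and $\alpha=\alpha(G)$. Suppose that $n\ge3\alpha$. If $$\left\lceil\frac{n-1}{4}\right\rceil\le\left\lfloor\frac{2\alpha-1}{3}\right\rfloor+1,$$ then the independence polynomial $I(G;x)$ is unimodal.
   Context: All graphs are finite, undirected and simple. $V(G)$ is the vertex set, $n(G)=|V(G)|$, and $\alpha(G)$ is the maximum cardinality of an independent set of $G$. A maximum independent set is an independent set of cardinality $\alpha(G)$. The empty set is an independent set. For an integer $p\ge1$, a graph $G$ belongs to $\mathbf{W}_p$ if $n(G)\ge p$ and, for every $p$ pairwise disjoint independent sets $A_1,\ldots,A_p$ of $G$ (possibly empty), there exist $p$ pairwise disjoint maximum independent sets $S_1,\ldots,S_p$ of $G$ such that $A_i\subseteq S_i$ for every $i$. The independence polynomial of $G$ is $I(G;x)=\sum_{k=0}^{\alpha(G)}s_kx^k$, where $s_k$ is the number of independent sets of $G$ of cardinality $k$. It is unimodal if there is an index $0\le t\le\alpha(G)$ such that $s_0\le\cdots\le s_{t-1}\le s_t\ge s_{t+1}\ge\cdots\ge s_{\alpha(G)}$. *)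

(* Defs.v *)
From mathcomp Require Export all_boot all_order all_algebra.

Set Implicit Arguments.
Unset Strict Implicit.
Unset Printing Implicit Defensive.

Export Order.TTheory GRing.Theory Num.Theory.

(* A graph on the vertex set V is given by its adjacency relation e. *)
Definition simple_graph (V : finType) (e : rel V) : Prop :=
  symmetric e /\ irreflexive e.

Definition connected_graph (V : finType) (e : rel V) : Prop :=
  0 < #|V| /\ (forall x y : V, connect e x y).

Definition independent (V : finType) (e : rel V) (A : {set V}) : bool :=
  [forall x in A, forall y in A, ~~ e x y].

Definition alpha (V : finType) (e : rel V) : nat :=
  \max_(A : {set V} | independent e A) #|A|.

Definition max_independent (V : finType) (e : rel V) (S : {set V}) : bool :=
  independent e S && (#|S| == alpha e).

Definition pairwise_disjoint (V : finType) (p : nat) (A : 'I_p -> {set V}) :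
    Prop :=
  forall i j : 'I_p, i != j -> [disjoint A i & A j].

(* Membership of the graph in the class W_p, used for p >= 1. *)
Definition in_W (p : nat) (V : finType) (e : rel V) : Prop :=
  p <= #|V| /\
  (forall A : 'I_p -> {set V},
     (forall i, independent e (A i)) -> pairwise_disjoint A ->
     exists S : 'I_p -> {set V},
       [/\ forall i, max_independent e (S i),
           pairwise_disjoint S
         & forall i, A i \subset S i]).

Definition indep_count (V : finType) (e : rel V) (k : nat) : nat :=
  #|[set A : {set V} | independent e A & #|A| == k]|.

Definition indep_poly (V : finType) (e : rel V) : {poly nat} :=
  (\poly_(k < (alpha e).+1) indep_count e k)%R.

Definition unimodal_upto (d : nat) (P : {poly nat}) : Prop :=
  exists t : nat,
    [/\ t <= d,
        forall k, k < t -> (P`_k)%R <= (P`_k.+1)%R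
      & forall k, t <= k < d -> (P`_k.+1)%R <= (P`_k)%R].

Definition indep_poly_unimodal (V : finType) (e : rel V) : Prop :=
  unimodal_upto (alpha e) (indep_poly e).

(* Main.v *)
Require Import Defs.
From mathcomp Require Import zify lra.

Set Implicit Arguments.
Unset Strict Implicit.
Unset Printing Implicit Defensive.

(** Write s_k for the number of independent sets of size k, and count the pairs
(A, v) where A is independent of size k and v lies outside the closed
neighbourhood N[A], so that A + v is again independent.  Each independent set
of size k+1 arises from k+1 such pairs, so (k+1) s_(k+1) is the sum over A of
the size of V \ N[A] ([sum_card_off]).  Two bounds on that size give the two
slopes of the sequence.

Lower bound.  The graph induced on V \ N[A] inherits the W_2 property and has
independence number alpha - k; a W_2 graph has two disjoint maximum independent
sets, so V \ N[A] has at least 2 (alpha - k) vertices.  Hence s_k <= s_(k+1) as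
long as k+1 <= 2 (alpha - k), that is, 3k <= 2 alpha - 1.

Upper bound.  A connected W_2 graph with n >= 3 alpha satisfies
2 |A| <= |N(A)| for every independent A ([w2_quasi_regularizable]), so V \ N[A]
has at most n - 3k vertices and s_(k+1) <= s_k as soon as n - 1 <= 4k.

The hypothesis on the ceiling and the floor says that the decrease starts no
later than the increase stops.

The heart is the inequality 2 |A| <= |N(A)|.  If N[A] = V it is the hypothesis
n >= 3 alpha.  Otherwise it holds in every connected W_2 graph, by induction
([w2_expands]).  By connectedness some x in N(A) has a neighbour u outside N[A].
If x misses a nonempty part K of A, apply induction to K, and to A \ K in the
graph without N[K], where x and u survive and still let A \ K escape.
Otherwise every such x is adjacent to all of A.  Let X be the intersection of
N(u) and N(A), and C = N[A] \ X.  Unless induction applies directly, to A in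
the graph without N[u] or to A minus one vertex in C, the set C is separated
from the rest of the graph by X.  Let Y be a maximum independent subset of X.
The graph without N[Y] is W_2, its part Q inside C avoids A, and
well-coveredness gives |Y| + alpha(Q) >= |A|.  On the other hand A is a maximum
independent set of the W_2 graph C, and |C| >= 2 |A| + alpha(Q)
([w2_dominated_card]): on a connected piece where alpha(Q) < |A| because
|C| >= 3 |A| - 1 (induction for A minus one vertex), and where alpha(Q) = |A|
because Q has at least 2 alpha(Q) vertices, all outside A.  Adding up,
|N(A)| = |X| + |C| - |A| >= |Y| + |A| + alpha(Q) >= 2 |A|.

All graphs in the induction are induced subgraphs, represented by vertex sets
W of the one ambient graph.  Connectedness does not survive the passage to
W \ N[K], so it is replaced by the condition that no union of components of W
that meets A lies inside N[A]. *)

(** * Independent sets inside a vertex set *)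

Section LocalW2.
Variables (V : finType) (e : rel V).
Hypotheses (e_sym : symmetric e) (e_irr : irreflexive e).
Implicit Types (A B C D I J K Q U W X Y : {set V}) (x y u v w : V).

Lemma independentP A :
  reflect (forall x y, x \in A -> y \in A -> ~~ e x y) (independent e A).
Proof.
apply: (iffP forall_inP) => [h x y /h /forall_inP h' /h' //|h x xA].
by apply/forall_inP => y; apply: h.
Qed.

Lemma independent_sub A B : A \subset B -> independent e B -> independent e A.
Proof.
move=> /subsetP AB /independentP h; apply/independentP => x y /AB xB /AB.
exact: h.
Qed.

Lemma independent0 : independent e set0.
Proof. by apply/independentP => x y; rewrite inE. Qed.

Lemma independent1 x : independent e [set x].
Proof. by apply/independentP => y z /set1P-> /set1P->; rewrite e_irr. Qed.

Definition nb A := [set y | [exists x in A, e x y]].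

Lemma nbP A y : reflect (exists2 x, x \in A & e x y) (y \in nb A).
Proof. by rewrite inE; apply: exists_inP. Qed.

Lemma nbU A B : nb (A :|: B) = nb A :|: nb B.
Proof.
apply/setP=> y; rewrite in_setU; apply/nbP/orP => [[x /setUP[]xA exy]|].
- by left; apply/nbP; exists x.
- by right; apply/nbP; exists x.
by case=> /nbP[x xA exy]; exists x => //; rewrite inE xA ?orbT.
Qed.

Lemma nbS A B : A \subset B -> nb A \subset nb B.
Proof. by move=> /setUidPr <-; rewrite nbU subsetUl. Qed.

Lemma independent_nb A x : independent e A -> x \in A -> x \notin nb A.
Proof. by move=> /independentP h xA; apply/nbP => -[y yA]; apply/negP/h. Qed.

Lemma mem_nb1 x y : (y \in nb [set x]) = e x y.
Proof. by apply/nbP/idP => [[z /set1P->]//|]; exists x; rewrite ?inE. Qed.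

(** The localization of the graph at A: what is left of W after A has been
chosen as part of an independent set. *)
Definition off W A := W :\: (A :|: nb A).

Lemma in_off W A x : (x \in off W A) = [&& x \in W, x \notin A & x \notin nb A].
Proof. by rewrite !in_setD in_setU negb_or andbC. Qed.

Lemma offS W A : off W A \subset W.
Proof. exact: subsetDl. Qed.

Lemma offU W A B : off (off W A) B = off W (A :|: B).
Proof. by rewrite /off setDDl nbU setUACA. Qed.

Lemma independentU W A B : independent e A -> independent e B ->
  B \subset off W A -> independent e (A :|: B).
Proof.
move=> iA iB /subsetP BA; apply/independentP => x y.
have h a b : a \in A -> b \in B -> ~~ e a b.
  move=> aA /BA; rewrite in_off => /and3P[_ _]; apply: contra => eab.
  by apply/nbP; exists a.
case/setUP=> xA /setUP[] yA; last exact: (independentP _ iB).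
- exact: (independentP _ iA).
- exact: h.
- by rewrite e_sym; exact: h.
Qed.

Lemma off_disjoint W A B : B \subset off W A -> [disjoint A & B].
Proof.
move=> /subsetP h; rewrite disjoint_sym; apply/pred0P => x /=; apply/andP=> -[/h].
by rewrite in_off => /and3P[_ /negP].
Qed.

Definition alpha_in W := \max_(A : {set V} | (A \subset W) && independent e A) #|A|.

Lemma leq_alpha_in W A : A \subset W -> independent e A -> #|A| <= alpha_in W.
Proof. by move=> AW iA; apply: leq_bigmax_cond; rewrite AW. Qed.

Lemma alpha_in_ex W :
  exists A, [/\ A \subset W, independent e A & #|A| = alpha_in W].
Proof.
have h : 0 < #|[pred A : {set V} | (A \subset W) && independent e A]|.
  by apply/card_gt0P; exists set0; rewrite inE sub0set independent0.
have [A] := eq_bigmax_cond (fun A : {set V} => #|A|) h.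
by rewrite inE => /andP[AW iA] E; exists A; split.
Qed.

Lemma alpha_in0 : alpha_in set0 = 0.
Proof.
by have [A [+ _ <-]] := alpha_in_ex set0; rewrite subset0 => /eqP->; rewrite cards0.
Qed.

Lemma alpha_inT : alpha_in setT = alpha e.
Proof. by apply: eq_bigl => A; rewrite subsetT. Qed.

Lemma alpha_inS U W : U \subset W -> alpha_in U <= alpha_in W.
Proof.
move=> UW; have [A [AU iA <-]] := alpha_in_ex U.
by apply: leq_alpha_in => //; apply: subset_trans UW.
Qed.

(** D is a union of connected components of the graph induced on W.  Working
with such unions instead of components avoids any reference to paths. *)
Definition edge_closed W D := (D \subset W) && (W :&: nb D \subset D).

Lemma closedP W D x y : edge_closed W D -> x \in D -> y \in W -> e x y -> y \in D.
Proof.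
move=> /andP[_ /subsetP h] xD yW exy; apply: h; rewrite inE yW /=.
by apply/nbP; exists x.
Qed.

Lemma closedI W D W' : edge_closed W D -> W' \subset W -> edge_closed W' (W' :&: D).
Proof.
move=> cD W'W; rewrite /edge_closed subsetIl; apply/subsetP => y /setIP[yW' /nbP[x]].
case/setIP=> _ xD exy; rewrite inE yW' (closedP cD xD _ exy) //.
exact: (subsetP W'W).
Qed.

Lemma closedC W D : edge_closed W D -> edge_closed W (W :\: D).
Proof.
move=> cD; rewrite /edge_closed subsetDl; apply/subsetP => y /setIP[yW /nbP[x]].
case/setDP=> xW xD exy; rewrite inE yW andbT; apply: contra xD => yD.
by apply: (closedP cD yD xW); rewrite e_sym.
Qed.

Lemma alpha_in_closed W D : edge_closed W D ->
  alpha_in W = alpha_in D + alpha_in (W :\: D).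
Proof.
move=> cD; have [DW _] := andP cD; apply/eqP; rewrite eqn_leq; apply/andP; split.
  have [A [AW iA <-]] := alpha_in_ex W; rewrite -(cardsID D A).
  apply: leq_add; apply: leq_alpha_in; rewrite ?subsetIr ?setSD //.
    by apply: independent_sub iA; rewrite subsetIl.
  by apply: independent_sub iA; rewrite subsetDl.
have [A [AW iA <-]] := alpha_in_ex D.
have [B [BW iB <-]] := alpha_in_ex (W :\: D).
have BoA : B \subset off W A.
  apply/subsetP => b /(subsetP BW) /setDP[bW bD]; rewrite in_off bW /=.
  apply/andP; split; first by apply: contra bD; apply: (subsetP AW).
  apply: contra bD => /nbP[a /(subsetP AW) aD]; exact: (closedP cD).
have -> : #|A| + #|B| = #|A :|: B|.
  by apply/esym/eqP; rewrite leq_card_setU; apply: off_disjoint BoA.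
apply: leq_alpha_in (independentU iA iB BoA).
by rewrite subUset (subset_trans AW DW) (subset_trans BoA (offS _ _)).
Qed.

(** * The W_2 property of induced subgraphs *)

(** A form of the W_2 property that visibly passes to localizations: the first
half says that W is well-covered, the second that no localization of W has an
isolated vertex.  An isolated vertex v left by I would be forced into every
maximum independent set that extends I, whereas W_2 provides one that is
disjoint from a maximum independent set containing v. *)
Definition w2 W := forall I, I \subset W -> independent e I ->
  alpha_in W = #|I| + alpha_in (off W I) /\
  (forall v, v \in off W I -> exists2 w, w \in off W I & e v w).

Lemma cardUoff W I J : J \subset off W I -> #|I :|: J| = #|I| + #|J|.
Proof.
by move=> JW; apply/eqP; rewrite leq_card_setU; apply: off_disjoint JW.
Qed.

Lemma w2_off W I : w2 W -> I \subset W -> independent e I -> w2 (off W I).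
Proof.
move=> wW IW iI J JW iJ; have [aI _] := wW I IW iI.
have IJW : I :|: J \subset W by rewrite subUset IW (subset_trans JW) ?offS.
have [aIJ nIJ] := wW _ IJW (independentU iI iJ JW).
rewrite !offU; split=> //; apply: (@addnI #|I|).
by rewrite -aI aIJ (cardUoff JW) addnA.
Qed.

Lemma off_closed W D I : edge_closed W D -> I \subset D ->
  D :&: off W I = off D I /\ W :\: D = off W I :\: off D I.
Proof.
move=> cD ID; have [/subsetP DW _] := andP cD.
have xout x : x \in W -> x \notin D -> (x \notin I) && (x \notin nb I).
  move=> xW xD; apply/andP; split; apply: contra xD; first exact: (subsetP ID).
  by case/nbP=> y /(subsetP ID) yD; apply: (closedP cD).
split; apply/setP=> x; rewrite !(in_off, in_setI, in_setD);
  case: (boolP (x \in D)) => [/DW ->|xD] //=; first by rewrite andNb.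
by case: (boolP (x \in W)) => //= xW; rewrite xout.
Qed.

(** Independence numbers add up over D and its complement in W, and the
complement contributes the same amount before and after localization. *)
Lemma w2_closed W D : w2 W -> edge_closed W D -> w2 D.
Proof.
move=> wW cD I ID iI; have [DW _] := andP cD.
have [offD WD] := off_closed cD ID.
have [aI nI] := wW I (subset_trans ID DW) iI.
have coff : edge_closed (off W I) (off D I).
  by rewrite -offD setIC; apply: closedI (offS _ _); rewrite // setIC.
split.
  apply: (@addIn (alpha_in (W :\: D))).
  by rewrite -alpha_in_closed // aI (alpha_in_closed coff) -WD addnA.
move=> v; rewrite -offD => /setIP[vD vo].
have [w wo evw] := nI v vo; exists w => //; rewrite inE wo andbT.
by apply: (closedP cD vD _ evw); apply: (subsetP (offS W I)).
Qed.

(** Take T largest among the independent sets that avoid A.  A vertex v of A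
left undominated by T would have an undominated neighbour w, which is outside A
and could be added to T; so T is maximal in W, hence maximum. *)
Lemma alpha_in_setD W A : w2 W -> independent e A ->
  alpha_in (W :\: A) = alpha_in W.
Proof.
move=> wW iA; apply/eqP; rewrite eqn_leq alpha_inS ?subsetDl //=.
have [T [TWA iT cT]] := alpha_in_ex (W :\: A).
have TW : T \subset W := subset_trans TWA (subsetDl _ _).
have [aT nT] := wW T TW iT.
have ext w : w \in off W T -> w \in A.
  move=> wo; apply: contraT => wA.
  have sw : [set w] \subset off W T by rewrite sub1set.
  have := leq_alpha_in (W := W :\: A) _ (independentU iT (independent1 w) sw).
  rewrite (cardUoff sw) cards1 cT addn1 ltnn; apply.
  by rewrite subUset TWA sub1set inE wA (subsetP (offS W T)).
suff o0 : off W T = set0 by rewrite aT o0 alpha_in0 addn0 cT.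
apply/setP=> v; rewrite in_set0; apply/negP => vo.
have [w /ext wA evw] := nT v vo.
by have /negP := independentP _ iA _ _ (ext _ vo) wA.
Qed.

Lemma leq_alpha_card W : alpha_in W <= #|W|.
Proof. by have [A [AW _ <-]] := alpha_in_ex W; apply: subset_leq_card. Qed.

(** Used with A of maximum size: a W_2 graph has at least twice as many vertices
as its independence number. *)
Lemma w2_card W A : w2 W -> A \subset W -> independent e A ->
  #|A| + alpha_in W <= #|W|.
Proof.
move=> wW AW iA; rewrite -(alpha_in_setD wW iA) -(cardsID A W) (setIidPr AW).
by rewrite leq_add2l leq_alpha_card.
Qed.

(** * Neighbourhoods of independent sets *)

(** The expansion inequality for all instances of measure below m; this is the
induction hypothesis of [w2_expands], and the lemmas that follow are parts of
its induction step.  The condition on D replaces the conditions that W be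
connected and that N[A] be smaller than W. *)
Definition expands m := forall W A, #|W| + #|A| < m -> w2 W -> A \subset W ->
  independent e A ->
  (forall D, edge_closed W D -> D \subset A :|: nb A -> [disjoint D & A]) ->
  2 * #|A| <= #|W :&: nb A|.

Lemma card_split C D X : X \subset C -> #|X| = #|D :&: X| + #|(C :\: D) :&: X|.
Proof. by move=> XC; rewrite setIDAC (setIidPr XC) (setIC D) cardsID. Qed.

(** Remove one vertex a from A.  Since a is outside N[A - a], the induction
hypothesis bounds the neighbourhood of A - a, and a has a further neighbour w
which is private to it, as a is not isolated in the localization at A - a. *)
Lemma w2_card3 m : expands m -> forall C A, #|C| + #|A| <= m ->
  w2 C -> A \subset C -> independent e A ->
  (forall D, edge_closed C D -> ~~ [disjoint D & A] -> A \subset D) ->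
  3 * #|A| <= #|C|.+1.
Proof.
move=> exm C A Cm wC AC iA conn.
have [->|[a aA]] := set_0Vmem A; first by rewrite cards0.
set B := A :\ a; have BA : B \subset A := subsetDl _ _.
have iB := independent_sub BA iA; have BC := subset_trans BA AC.
have cA : #|A| = #|B|.+1 by rewrite (cardsD1 a) aA.
have aB : a \notin nb B.
  by apply: contra (independent_nb iA aA); apply: (subsetP (nbS BA)).
have aoB : a \in off C B by rewrite in_off (subsetP AC) // aB setD11.
have exB : 2 * #|B| <= #|C :&: nb B|.
  apply: exm => //; first by move: Cm; rewrite cA; clear; lia.
  move=> D cD DB; apply: contraT => dDB.
  have aD : a \in D.
    apply: (subsetP (conn D cD _) a aA); apply: contra dDB.
    by apply: disjointWr.
  by have := subsetP DB a aD; rewrite in_setU setD11 (negPf aB).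
have [_ /(_ a aoB)[w]] := wC B BC iB; rewrite in_off => /and3P[wC' wB wnB] eaw.
have wA : w \notin A.
  by apply/negP => wA; have /negP := independentP _ iA _ _ aA wA.
have : #|w |: A| <= #|C :\: nb B|.
  apply/subset_leq_card/subsetP => y; rewrite in_setD => /setU1P[->|yA].
    by rewrite wnB wC'.
  rewrite (subsetP AC) // andbT; apply: contra (independent_nb iA yA).
  exact: (subsetP (nbS BA)).
rewrite cardsU1 wA -(cardsID (nb B) C); move: exB; rewrite cA; clear.
by lia.
Qed.

(** Both sides are additive over unions of components, so C may be taken
connected.  There the two available bounds on |C|, namely 3 |A| - 1 and
|A| + |Q| >= |A| + 2 alpha(Q), cover the cases alpha(Q) < |A| and
alpha(Q) >= |A|. *)
Lemma w2_dominated_card m : expands m -> forall C Q A, #|C| + #|A| <= m ->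
  w2 C -> w2 Q -> Q \subset C -> A \subset C -> independent e A ->
  alpha_in C = #|A| -> [disjoint Q & A] -> 2 * #|A| + alpha_in Q <= #|C|.
Proof.
move=> exm C; have [n] := ubnP #|C|.
elim: n C => // n IH C Cn Q A Cm wC wQ QC AC iA aC dQA.
case: (boolP [exists D : {set V}, [&& edge_closed C D, D != set0 & D != C]]).
  case/existsP=> D /and3P[cD D0 DC].
  have cE := closedC cD; set E := C :\: D in cE.
  have [sD _] := andP cD; have sE : E \subset C := subsetDl _ _.
  have cardC : #|C| = #|D| + #|E| by rewrite -(cardsID D C) (setIidPr sD).
  have cardA := card_split D AC; rewrite -/E in cardA.
  have aDE := alpha_in_closed cD; rewrite -/E in aDE.
  have ltDC : #|D| < #|C| by rewrite proper_card // properEneq DC.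
  have ltEC : #|E| < #|C| by rewrite cardC -[ltnLHS]add0n ltn_add2r card_gt0.
  have aQ : alpha_in Q = alpha_in (Q :&: D) + alpha_in (Q :&: E).
    rewrite (alpha_in_closed (closedI cD QC)) /E setIDA (setIidPl QC).
    by rewrite setDIr setDv set0U.
  have step F : edge_closed C F -> #|F| < #|C| -> alpha_in F = #|F :&: A| ->
      2 * #|F :&: A| + alpha_in (Q :&: F) <= #|F|.
    move=> cF ltF aF; have [sF _] := andP cF.
    apply: IH => //; rewrite ?subsetIr ?subsetIl //.
    - by apply: leq_trans ltF _.
    - by apply: leq_trans Cm; rewrite leq_add ?subset_leq_card ?subsetIr.
    - exact: w2_closed wC cF.
    - exact: w2_closed wQ (closedI cF QC).
    - by apply: independent_sub iA; rewrite subsetIr.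
    - by apply: disjointW dQA; rewrite ?subsetIr ?subsetIl.
  have bnd F : #|F :&: A| <= alpha_in F.
    by rewrite leq_alpha_in ?subsetIl // (independent_sub _ iA) ?subsetIr.
  have [aD aE] : alpha_in D = #|D :&: A| /\ alpha_in E = #|E :&: A|.
    by move: (bnd D) (bnd E) aC; rewrite aDE cardA; clear; lia.
  move: (step D cD ltDC aD) (step E cE ltEC aE).
  by rewrite cardC cardA aQ; clear; lia.
rewrite negb_exists => /forallP conn.
have [ltQ|geQ] := ltnP (alpha_in Q) #|A|.
  have : 3 * #|A| <= #|C|.+1.
    apply: (w2_card3 exm) => // D cD; have := conn D; rewrite cD /= negb_and !negbK.
    by case/orP=> /eqP-> //; rewrite disjoints_subset sub0set.
  by move: ltQ; clear; lia.
have [T [TQ iT cT]] := alpha_in_ex Q.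
have := w2_card wQ TQ iT.
have : #|A :|: Q| <= #|C| by rewrite subset_leq_card // subUset AC.
have -> : #|A :|: Q| = #|A| + #|Q|.
  by apply/eqP; rewrite leq_card_setU disjoint_sym.
by rewrite cT; move: geQ; clear; lia.
Qed.

Lemma ltn_card_off W A : A \subset W -> A != set0 -> #|off W A| < #|W|.
Proof.
move=> AW /set0Pn[a aA]; apply: proper_card; apply/properP; split.
  exact: offS.
by exists a; rewrite ?in_off ?aA ?andbF //; apply: (subsetP AW).
Qed.

(** The part K of A not adjacent to x and the part B adjacent to x are treated
separately: N(K) and the neighbourhood of B in W \ N[K] are disjoint.  The edge
from x to u survives in W \ N[K] and lets every component that meets B reach a
vertex outside N[B]. *)
Lemma escape_split m W A x u : expands m -> #|W| + #|A| <= m -> w2 W ->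
  A \subset W -> independent e A ->
  (forall D, edge_closed W D -> D \subset A :|: nb A -> [disjoint D & A]) ->
  x \in W -> x \in nb A -> u \in off W A -> e x u -> ~~ (A \subset nb [set x]) ->
  2 * #|A| <= #|W :&: nb A|.
Proof.
move=> exm Wm wW AW iA hD xW xA; rewrite in_off => /and3P[uW uA unA] exu.
case/subsetPn=> z zA zx.
have uN : u \notin A :|: nb A by rewrite in_setU negb_or uA.
set K := A :\: nb [set x]; set B := A :&: nb [set x].
have KA : K \subset A := subsetDl _ _; have BA : B \subset A := subsetIl _ _.
have cA : #|A| = #|B| + #|K| by rewrite cardsID.
have [a aA eax] := nbP _ _ xA.
have B_gt0 : 0 < #|B|.
  by apply/card_gt0P; exists a; rewrite in_setI aA mem_nb1 e_sym.
have K0 : K != set0 by apply/set0Pn; exists z; rewrite in_setD zA zx.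
have KW := subset_trans KA AW; have BW := subset_trans BA AW.
have iK := independent_sub KA iA; have iB := independent_sub BA iA.
have BoK : B \subset off W K.
  apply/subsetP => b bB; have bA := subsetP BA _ bB.
  have bK : b \notin K by rewrite in_setD; case/setIP: bB => _ ->.
  rewrite in_off (subsetP BW) // bK /=; apply: contra (independent_nb iA bA).
  exact: (subsetP (nbS KA)).
have ltK := ltn_card_off KW K0.
have exK : 2 * #|K| <= #|W :&: nb K|.
  apply: exm => //; first by move: Wm B_gt0; rewrite cA; clear; lia.
  move=> D cD DK; apply: (disjointWr KA); apply: hD => //; apply: (subset_trans DK).
  exact: setUSS KA (nbS KA).
have exB : 2 * #|B| <= #|off W K :&: nb B|.
  apply: exm => //; first by move: Wm ltK; rewrite cA; clear; lia.
    exact: w2_off.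
  move=> D cD DB; apply: contraT => /pred0Pn[d /andP[/= dD dB]].
  have xoK : x \in off W K.
    have xnA : x \notin A by apply: contraL xA; apply: independent_nb.
    have xK : x \notin K by rewrite in_setD (negPf xnA) andbF.
    rewrite in_off xW xK /=; apply/nbP => -[k kK ekx]; have [_] := setDP kK.
    by rewrite mem_nb1 e_sym ekx.
  have uoK : u \in off W K.
    rewrite in_off uW /=; apply/andP; split.
      by apply: contra uA; apply: (subsetP KA).
    by apply: contra unA; apply: (subsetP (nbS KA)).
  have exd : e d x by have [_] := setIP dB; rewrite mem_nb1 e_sym.
  have uD := closedP cD (closedP cD dD xoK exd) uoK exu.
  by case/negP: uN; apply: (subsetP (setUSS BA (nbS BA))); apply: (subsetP DB).
rewrite -(cardsID (nb K) (W :&: nb A)) cA mulnDr addnC leq_add //.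
  apply: leq_trans exK _; apply: subset_leq_card; apply/subsetP => y.
  rewrite !in_setI => /andP[-> yK]; rewrite yK andbT /=.
  exact: (subsetP (nbS KA)).
apply: leq_trans exB _; apply: subset_leq_card; apply/subsetP => y.
rewrite in_setI in_off in_setD in_setI => /andP[/and3P[-> _ ->]] /=.
exact: (subsetP (nbS BA)).
Qed.

(** The measure is |W| + |A| because one branch keeps W and passes to a smaller
set K, while all the others pass to a smaller graph. *)
Lemma w2_expands m : expands m.
Proof.
elim: m => [|m exm] W A //; rewrite ltnS => Wm wW AW iA hD.
have [->|A0] := eqVneq A set0; first by rewrite cards0.
have [x [u [/setIP[xW xA] uoA exu]]] :
    exists x u, [/\ x \in W :&: nb A, u \in off W A & e x u].
  case: (boolP (edge_closed W (A :|: (W :&: nb A)))) => [cN|].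
    have := hD _ cN; rewrite setUS ?subsetIr // => /(_ isT) /pred0P AA.
    by have [a aA] := set0Pn _ A0; have := AA a; rewrite /= in_setU aA.
  rewrite /edge_closed subUset AW subsetIl /= => /subsetPn[u /setIP[uW /nbP[x xN exu]]].
  rewrite in_setU in_setI uW negb_or /= => /andP[uA unA].
  exists x, u; split => //; last by rewrite in_off uW uA.
  case/setUP: xN => // xA; case/negP: unA; apply/nbP; by exists x.
case: (boolP [exists y in W :&: nb A,
  [exists v in off W A, e y v && ~~ (A \subset nb [set y])]]).
  case/exists_inP => y /setIP[yW yA] /exists_inP[v voA /andP[eyv yn]].
  exact: (escape_split exm) yW yA voA eyv yn.
move=> nesc.
(* From here on, every vertex of N(A) with a neighbour outside N[A] is adjacent
   to all of A. *)
have full y v : y \in W -> y \in nb A -> v \in off W A -> e y v -> A \subset nb [set y].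
  move=> yW yA voA eyv; apply: contraT => yn; case/negP: nesc.
  apply/exists_inP; exists y; first by rewrite in_setI yW.
  by apply/exists_inP; exists v; rewrite // eyv.
have {nesc} inN D y v : y \in W -> y \in nb A -> v \in off W A -> e y v ->
    forall W', edge_closed W' D -> y \in W' -> v \in W' -> ~~ [disjoint D & A] -> v \in D.
  move=> yW yA voA eyv W' cD yW' vW' /pred0Pn[d /andP[/= dD dA]].
  apply: (closedP cD _ vW' eyv); apply: (closedP cD dD yW' _).
  by have := subsetP (full _ _ yW yA voA eyv) _ dA; rewrite mem_nb1 e_sym.
move: (uoA); rewrite in_off => /and3P[uW uA unA].
set W' := off W [set u].
have inW' y : (y \in W') = [&& y \in W, y != u & ~~ e u y].
  by rewrite in_off mem_nb1 in_set1.
have u1W : [set u] \subset W by rewrite sub1set.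
have wW' : w2 W' by apply: w2_off (independent1 u).
have W'W : W' \subset W := offS _ _.
have ltW' : #|W'| < #|W|.
  by apply: ltn_card_off => //; apply/set0Pn; exists u; rewrite in_set1.
have AW' : A \subset W'.
  apply/subsetP => a aA; rewrite inW' (subsetP AW) //=; apply/andP; split.
    by apply: contraNneq uA => <-.
  by apply: contra unA => eua; apply/nbP; exists a; rewrite // e_sym.
(* If an edge still leaves N[A] after localization at u, its end y in N(A) is
   adjacent to all of A, so A satisfies the induction hypothesis in W'. *)
case: (boolP [exists y in W' :&: nb A, [exists v in W' :&: off W A, e y v]]).
  case/exists_inP => y /setIP[yW' yA] /exists_inP[v /setIP[vW' voA] eyv].
  apply: (@leq_trans #|W' :&: nb A|); last by rewrite subset_leq_card // setSI.
  apply: exm => //; first by move: Wm ltW'; clear; lia.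
  move=> D cD DN; apply: contraT => dD.
  have vD := inN D y v (subsetP W'W _ yW') yA voA eyv W' cD yW' vW' dD.
  have := subsetP DN _ vD; move: voA; rewrite in_off in_setU.
  by move=> /and3P[_ /negPf-> /negPf->].
move=> noedge.
set C := W' :&: (A :|: nb A).
have cC : edge_closed W' C.
  rewrite /edge_closed subsetIl; apply/subsetP => v.
  case/setIP=> vW' /nbP[y /setIP[yW' yN] eyv].
  rewrite in_setI vW' in_setU /=; case/setUP: yN => yA.
    by apply/orP; right; apply/nbP; exists y.
  rewrite -[_ || _]negbK negb_or; apply: contra noedge => vN.
  apply/exists_inP; exists y; first by rewrite in_setI yW'.
  by apply/exists_inP; exists v; rewrite // in_setI vW' in_off (subsetP W'W).
have wC := w2_closed wW' cC.
have AC : A \subset C by rewrite subsetI AW' subsetUl.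
have CW : C \subset W' := subsetIl _ _.
have leCW := subset_leq_card CW.
have Cm : #|C| + #|A| <= m by move: Wm ltW' leCW; clear; lia.
set X := W :&: nb A :&: nb [set u].
have xX : x \in X by rewrite !in_setI xW xA mem_nb1 e_sym.
have cardX : #|W :&: nb A| + #|A| = #|X| + #|C|.
  rewrite -(cardsID (nb [set u]) (W :&: nb A)) -addnA; congr (_ + _).
  rewrite -(cardsID A C) addnC; congr (_ + _).
    by rewrite (setIidPr AC).
  apply: eq_card => y; rewrite in_setD in_setI mem_nb1 in_setD in_setI inW' in_setU.
  case: (boolP (y \in A)) => [yA|_] /=.
    by rewrite (negPf (independent_nb iA yA)) !andbF.
  case: eqVneq => [->|_]; first by rewrite (negPf unA) !andbF.
  by rewrite /= [in RHS]andbAC andbC.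
(* If some y of C is adjacent to all of A, then A lies in a single component of
   C, so that |C| >= 3 |A| - 1; the missing unit is supplied by x in X. *)
case: (boolP [exists y in C :&: nb A, A \subset nb [set y]]).
  case/exists_inP => y /setIP[yC yA] yfull.
  have : 3 * #|A| <= #|C|.+1.
    apply: (w2_card3 exm) => // D cD /pred0Pn[d /andP[/= dD dA]].
    have yD : y \in D.
      by apply: (closedP cD dD yC _); have := subsetP yfull _ dA; rewrite mem_nb1 e_sym.
    apply/subsetP => a aA; apply: (closedP cD yD (subsetP AC _ aA) _).
    by have := subsetP yfull _ aA; rewrite mem_nb1.
  have : 0 < #|X| by apply/card_gt0P; exists x.
  by move: cardX; clear; lia.
move=> nofull.
have [Y [YX iY cY]] := alpha_in_ex X.
have XW : X \subset W by rewrite /X -setIA subsetIl.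
have YW := subset_trans YX XW.
have offX y : y \in off W Y -> y \notin X.
  move=> yo; apply/negP => yX; have y1 : [set y] \subset off W Y by rewrite sub1set.
  have := leq_alpha_in (W := X) _ (independentU iY (independent1 y) y1).
  rewrite (cardUoff y1) cards1 cY addn1 ltnn => h.
  by have // := h; rewrite subUset YX sub1set => /(_ yX).
have AY : A \subset nb Y.
  have : 0 < #|Y|.
    by rewrite cY -(cards1 x) leq_alpha_in ?sub1set ?independent1.
  case/card_gt0P => y yY; have := subsetP YX _ yY.
  rewrite !in_setI mem_nb1 => /andP[/andP[yW yA] euy].
  apply: subset_trans (full y u yW yA uoA _) (nbS _); last by rewrite sub1set.
  by rewrite e_sym.
set Q := off W Y :&: C.
(* Q has no edge to the rest of W \ N[Y]: the vertices of X are gone, and any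
   other edge leaving C would have an end adjacent to all of A. *)
have cQ : edge_closed (off W Y) Q.
  rewrite /edge_closed subsetIl; apply/subsetP => v /setIP[vo /nbP[q /setIP[qo qC] eqv]].
  rewrite in_setI vo /=; have vW := subsetP (offS _ _) _ vo.
  case: (boolP (v \in W')) => [vW'|]; first exact: closedP cC qC vW' eqv.
  rewrite inW' vW /= negb_and !negbK; move: (offX v vo).
  have qnA : q \in nb A.
    case/setIP: qC => qW' /setUP[qA|//].
    by have := subsetP AY _ qA; move: qo; rewrite in_off => /and3P[_ _ /negPf->].
  have qW : q \in W by apply: (subsetP (offS W Y)).
  have vnA : v \in nb A.
    apply: contraT => vnA; case: (boolP (v \in A)) => vA.
      by have := subsetP AY _ vA; move: vo; rewrite in_off => /and3P[_ _ /negPf->].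
    case/negP: nofull; apply/exists_inP; exists q; first by rewrite in_setI qC.
    by apply: (full q v qW qnA _ eqv); rewrite in_off vW vA.
  rewrite !in_setI vW vnA mem_nb1 /= => /negPf->; rewrite orbF => /eqP vu.
  by case/negP: unA; rewrite -vu.
have wQ : w2 Q by apply: w2_closed cQ; apply: w2_off.
have aC : alpha_in C = #|A|.
  have [-> _] := wC A AC iA; suff -> : off C A = set0 by rewrite alpha_in0 addn0.
  apply/setP => y; rewrite in_off in_setI in_setU in_set0.
  by case: (y \in A); case: (y \in nb A); rewrite ?andbF.
have dQA : [disjoint Q & A].
  apply/pred0P => y /=; apply/andP => -[/setIP[yo _] /(subsetP AY)].
  by move: yo; rewrite in_off => /and3P[_ _ /negPf->].
have leC := w2_dominated_card exm Cm wC wQ (subsetIr _ _) AC iA aC dQA.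
(* This bounds the independence number of W \ N[Y] by alpha(Q) + alpha(W \ N[A]);
   well-coveredness then yields |A| <= |Y| + alpha(Q). *)
have rest : off W Y :\: Q \subset off W A.
  apply/subsetP => z /setDP[zo]; rewrite in_setI zo /= => zC.
  have zW := subsetP (offS _ _) _ zo; rewrite in_off zW /=.
  have zA : z \notin A.
    apply/negP => /(subsetP AY) zY; move: zo; rewrite in_off zY.
    by rewrite !andbF.
  rewrite zA /=; apply: contra (offX z zo) => znA.
  rewrite !in_setI zW znA mem_nb1; move: zC.
  rewrite in_setI in_setU znA orbT andbT inW' zW /= negb_and !negbK.
  by case/orP=> // /eqP zu; case/negP: unA; rewrite -zu.
have := alpha_inS rest; have leY : #|Y| <= #|X| := subset_leq_card YX.
have [aW _] := wW A AW iA; have [aW' _] := wW Y YW iY.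
have := alpha_in_closed cQ.
move: aW'; rewrite aW; move: leC cardX leY; clear; lia.
Qed.
End LocalW2.

(** * Counting independent sets by extension *)

Lemma ceil_le_floor (n a : nat) : 0 < a ->
  (Num.ceil ((n%:R - 1) / 4%:R : rat)
     <= Num.floor ((2%:R * a%:R - 1) / 3%:R : rat) + 1)%R ->
  n <= (4 * ((2 * a).-1 %/ 3).+1).+1.
Proof.
move=> a0; set c := Num.ceil _; set f := Num.floor _ => cf.
have hc : (n%:Z - 1 <= 4 * c)%R.
  rewrite -(ler_int rat) rmorphB rmorphM /=.
  have := ceil_ge ((n%:R - 1) / 4%:R : rat); rewrite -/c.
  by rewrite -[Posz n]natz -!pmulrn; lra.
have hf : (3 * f <= 2 * a%:Z - 1)%R.
  rewrite -(ler_int rat) rmorphB !rmorphM /=.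
  have := floor_le ((2%:R * a%:R - 1) / 3%:R : rat); rewrite -/f.
  by rewrite -[Posz a]natz -!pmulrn; lra.
by lia.
Qed.

Section Counting.
Variables (V : finType) (e : rel V).
Hypotheses (e_sym : symmetric e) (e_irr : irreflexive e).
Implicit Types (A B S : {set V}).

Lemma in_W2_disjoint A B : in_W 2 e -> independent e A -> independent e B ->
  [disjoint A & B] -> exists S T : {set V},
    [/\ max_independent e S, max_independent e T, [disjoint S & T],
        A \subset S & B \subset T].
Proof.
move=> [_ hW] iA iB dAB.
have [||S [mS dS sS]] := hW (fun i => if i == ord0 then A else B).
- by move=> i; case: ifP.
- move=> i j; case: (i =P ord0) => [->|/eqP i0]; case: (j =P ord0) => [->|/eqP j0] //=.
  + by rewrite disjoint_sym.
  + case/eqP; apply: val_inj; case: i j i0 j0 => [[|[|i]] hi] [[|[|j]] hj] //=.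
exists (S ord0), (S ord_max); split=> //.
- exact: dS.
- exact: (sS ord0).
- exact: (sS ord_max).
Qed.

Lemma in_W2_w2 : in_W 2 e -> w2 e setT.
Proof.
move=> hW I _ iI; rewrite alpha_inT; split.
  apply/eqP; rewrite eqn_leq; apply/andP; split.
    have [|S [T [/andP[iS /eqP <-] _ _ IS _]]] := in_W2_disjoint hW iI (independent0 e).
      by rewrite disjoint_sym disjoints_subset sub0set.
    rewrite -(cardsID I S) (setIidPr IS) leq_add2l; apply: leq_alpha_in.
      apply/subsetP => s /setDP[sS sI]; rewrite in_off in_setT sI /=.
      by apply: contra (independent_nb iS sS); apply: (subsetP (nbS e IS)).
    by apply: independent_sub iS; rewrite subsetDl.
  have [T [Toff iT <-]] := alpha_in_ex e (off e setT I).
  rewrite -(cardUoff Toff) -alpha_inT; apply: leq_alpha_in (subsetT _) _.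
  exact: independentU iT Toff.
move=> v; rewrite in_off => /and3P[_ vI vnI].
have [||S [T [/andP[iS /eqP cS] /andP[iT /eqP cT] dST vS IT]]] :=
    @in_W2_disjoint [set v] I hW _ iI.
- exact: independent1.
- by rewrite disjoints1.
have vT : v \notin T.
  by rewrite (disjointFr dST) // (subsetP vS) ?inE.
apply/exists_inP; apply: contraT => /exists_inPn vn.
have Tv : [set v] \subset off e setT T.
  rewrite sub1set in_off in_setT vT; apply/nbP => -[s sT esv].
  have evs : e v s by rewrite e_sym.
  suff so : s \in off e setT I by have := vn s so; rewrite evs.
  rewrite in_off in_setT /=; apply/andP; split.
    by apply: contra vnI => sI; apply/nbP; exists s.
  by apply: contra (independent_nb iT sT); apply: (subsetP (nbS e IT)).
have := leq_alpha_in (subsetT _) (independentU e_sym iT (independent1 e_irr v) Tv).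
by rewrite (cardUoff Tv) cards1 cT alpha_inT addn1 ltnn.
Qed.

(** Double counting of the pairs (A, v) with v outside N[A], matched with the
pairs (B, v) with v in B through B = A + v. *)
Lemma sum_card_off k :
  \sum_(A : {set V} | independent e A && (#|A| == k)) #|off e setT A|
    = k.+1 * indep_count e k.+1.
Proof.
transitivity (\sum_(v : V) \sum_(A : {set V} |
    independent e A && (#|A| == k) && (v \in off e setT A)) 1).
  rewrite -(exchange_big_dep predT) //=.
  by apply: eq_bigr => A _; rewrite sum1_card.
transitivity (\sum_(v : V) \sum_(B : {set V} |
    independent e B && (#|B| == k.+1) && (v \in B)) 1).
  apply: eq_bigr => v _.
  rewrite [RHS](reindex_onto (fun A => v |: A) (fun B => B :\ v)); last first.
    by move=> B /andP[_ vB]; rewrite setD1K.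
  apply: eq_bigl => A; rewrite setU11 andbT.
  case: (boolP (v \in A)) => vA.
    rewrite in_off vA !andbF; apply/esym/negP => /andP[_ /eqP E].
    by have := setD11 v (v |: A); rewrite E vA.
  rewrite setU1K // eqxx andbT cardsU1 vA add1n eqSS in_off in_setT vA /= andbAC.
  congr (_ && _); apply/andP/idP => [[iA vnA]|iA].
    rewrite setUC; apply: (@independentU _ _ e_sym setT) (independent1 e_irr v) _ => //.
    by rewrite sub1set in_off in_setT vA.
  split; first by apply: independent_sub iA; rewrite subsetUr.
  apply: contra (independent_nb iA (setU11 v A)).
  by apply: (subsetP (nbS e _)); rewrite subsetUr.
rewrite -(exchange_big_dep predT (P := fun B => independent e B && (#|B| == k.+1))
   (Q := fun B v => v \in B)) //=.
rewrite (eq_bigr (fun=> k.+1)) => [|B /andP[_ /eqP <-]]; last by rewrite sum1_card.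
by rewrite sum_nat_cond_const mulnC.
Qed.

Lemma indep_count_incr k : w2 e setT -> k.+1 <= 2 * (alpha e - k) ->
  indep_count e k <= indep_count e k.+1.
Proof.
move=> wV hk; rewrite -(leq_pmul2l (ltn0Sn k)) -sum_card_off.
rewrite mulnC -sum_nat_cond_const; apply: leq_sum => A /andP[iA /eqP cA].
apply: leq_trans hk _.
have [aA _] := wV A (subsetT A) iA.
have wA := w2_off e_sym wV (subsetT A) iA.
have [T [TA iT cT]] := alpha_in_ex e (off e setT A).
have := w2_card e_sym e_irr wA TA iT.
by rewrite cT -alpha_inT aA cA addKn mul2n -addnn.
Qed.

(** If N[A] is everything then |N(A)| = n - |A| and the hypothesis on n applies;
otherwise [w2_expands] does, the only nonempty union of components being the
whole vertex set. *)
Lemma w2_quasi_regularizable A : w2 e setT -> connected_graph e ->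
  3 * alpha e <= #|V| -> independent e A -> 2 * #|A| <= #|nb e A|.
Proof.
move=> wV [_ conn] hn iA; rewrite -[nb e A]setTI.
have [dom|ndom] := eqVneq (A :|: nb e A) setT.
  have leA : #|A| <= alpha e by rewrite -alpha_inT leq_alpha_in ?subsetT.
  have : #|nb e A| + #|A| = #|V|.
    rewrite -cardsT -dom setUC; apply/esym/eqP; rewrite leq_card_setU.
    rewrite disjoint_sym disjoints_subset; apply/subsetP => a aA.
    by rewrite in_setC independent_nb.
  by rewrite setTI; lia.
apply: (w2_expands e_sym e_irr (ltnSn _)) (subsetT A) iA _ => // D cD DA.
apply: contraT => /pred0Pn[d /andP[/= dD _]]; case/negP: ndom.
rewrite eqEsubset subsetT /=; apply: subset_trans DA; apply/subsetP => y _.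
have /connectP[p + ->] := conn d y.
elim: p d dD => //= z p IH d dD /andP[edz]; apply: IH.
exact: closedP cD dD (in_setT _) edz.
Qed.

Lemma indep_count_decr k : w2 e setT -> connected_graph e ->
  3 * alpha e <= #|V| -> #|V| <= 4 * k + 1 ->
  indep_count e k.+1 <= indep_count e k.
Proof.
move=> wV conn hn hk; rewrite -(leq_pmul2l (ltn0Sn k)) -sum_card_off.
rewrite [leqRHS]mulnC -sum_nat_cond_const; apply: leq_sum => A /andP[iA /eqP cA].
have := w2_quasi_regularizable wV conn hn iA.
have := cardsC (A :|: nb e A); rewrite -setTD -/(off e setT A).
have -> : #|A :|: nb e A| = #|A| + #|nb e A|.
  apply/eqP; rewrite leq_card_setU disjoints_subset; apply/subsetP => a aA.
  by rewrite in_setC independent_nb.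
by rewrite cA; move: hk; clear; lia.
Qed.

End Counting.

Theorem corollary6p3 (V : finType) (e : rel V)
  (he : simple_graph e)
  (hconn : connected_graph e)
  (hW2 : in_W 2 e)
  (hn : 3 * alpha e <= #|V|)
  (hceil : (Num.ceil ((#|V|%:R - 1) / 4%:R : rat)
            <= Num.floor ((2%:R * (alpha e)%:R - 1) / 3%:R : rat) + 1)%R) :
  indep_poly_unimodal e.
Proof.
have [e_sym e_irr] := he.
have wV := in_W2_w2 e_sym e_irr hW2.
have alpha_gt0 : 0 < alpha e.
  have [/card_gt0P[v _] _] := hconn; rewrite -alpha_inT -(cards1 v).
  by apply: leq_alpha_in; rewrite ?subsetT ?independent1.
have hV := ceil_le_floor alpha_gt0 hceil.
exists ((2 * alpha e).-1 %/ 3).+1; rewrite /indep_poly; split.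
- by move: alpha_gt0; clear; lia.
- move=> k kt; rewrite !coef_poly !ifT; [|lia..].
  by apply: indep_count_incr => //; move: kt alpha_gt0; clear; lia.
move=> k /andP[tk ka]; rewrite !coef_poly !ifT; [|lia..].
by apply: indep_count_decr => //; move: tk hV; clear; lia.
Qed.
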